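(* There exist a constant $C>0$ and a probability measure $\mu$ supported on the set of absolutely non-normal numbers such that $$\bigl|\widehat{\mu}(n)\bigr|\le C\bigl(\log^{(3)}|n|\bigr)^{-1}\quad\text{for all } n\in\mathbb Z,\ |n|\ge C .$$ Here $\log^{(n)}$ denotes the $n$-fold composition of the logarithm.
   Context: Normality: for an integer $b\ge 2$ and $x\in[0,1)$ write $x=\sum_{j\ge1}x_jb^{-j}$ with digits $x_j\in\{0,\dots,b-1\}$. The number $x$ is $b$-normal if for every $k\ge1$ and every $(d_1,\dots,d_k)\in\{0,\dots,b-1\}^k$, $\lim_{N\to\infty}\frac1N\#\{1\le n\le N:(x_n,\dots,x_{n+k-1})=(d_1,\dots,d_k)\}=b^{-k}$. The number $x$ is absolutely non-normal if it is not $b$-normal for any integer $b\ge2$. Here $\mu$ is a Borel probability measure on $[0,1)$, $\widehat\mu(n)=\int_0^1e^{-2\pi inx}\,d\mu(x)$, and ''supported on the set of absolutely non-normal numbers'' means that $\mu$-almost every point is absolutely non-normal. $\log^{(3)}|n|=\log\log\log|n|$. *)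

(* Defs.v *)
From HB Require Import structures.
From mathcomp Require Import all_boot all_order all_algebra.
From mathcomp Require Import all_classical all_reals all_analysis.
From mathcomp Require Import complex.
Set Implicit Arguments.
Unset Strict Implicit.
Unset Printing Implicit Defensive.
Import Order.TTheory GRing.Theory Num.Theory.
Import numFieldNormedType.Exports.
Local Open Scope classical_set_scope.
Local Open Scope ring_scope.
Local Open Scope complex_scope.

Section digits.
Variable R : realType.

(* The j-th digit (j >= 1) after the radix point of x in base b, meaningful for
   0 <= x: for an x in [0, 1) with two expansions it selects the finite one. *)
Definition digit (b : nat) (x : R) (j : nat) : nat :=
  (Num.truncn (b%:R ^+ j * x) %% b)%N.

Lemma ltn_digit (b : nat) (x : R) (j : nat) : (2 <= b)%N -> (digit b x j < b)%N.
Proof. by move=> b2; rewrite ltn_mod (leq_trans _ b2). Qed.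

Lemma truncn_digit (b : nat) (x : R) (j : nat) : (2 <= b)%N -> 0 <= x ->
  Num.truncn (b%:R ^+ j.+1 * x)
  = (Num.truncn (b%:R ^+ j * x) * b + digit b x j.+1)%N.
Proof.
move=> b2 x0; have b0 : (0 < b)%N by exact: leq_trans b2.
have bR0 : 0 < b%:R :> R by rewrite ltr0n.
rewrite [LHS](divn_eq _ b) /digit; congr (_ * b + _)%N.
have y0 i : 0 <= b%:R ^+ i * x by rewrite mulr_ge0// exprn_ge0// ltW.
apply/esym/truncn_def/andP; have /andP[l u] := truncn_itv (y0 j.+1).
split.
  rewrite -(ler_pM2l bR0) mulrA -exprS -natrM; apply: le_trans l.
  by rewrite ler_nat mulnC leq_divM.
rewrite -(ltr_pM2l bR0) mulrA -exprS -natrM; apply: lt_le_trans u _.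
by rewrite ler_nat mulnC ltn_ceil.
Qed.

Lemma series_digit (b : nat) (x : R) : (2 <= b)%N -> 0 <= x < 1 ->
  (fun N => \sum_(1 <= j < N.+1) (digit b x j)%:R / b%:R ^+ j) @ \oo --> x.
Proof.
move=> b2 /andP[x0 x1]; have b0 : (0 < b)%N by exact: leq_trans b2.
have bR0 : 0 < b%:R :> R by rewrite ltr0n.
have bn0 i : 0 < b%:R ^+ i :> R by rewrite exprn_gt0.
have sE N : \sum_(1 <= j < N.+1) (digit b x j)%:R / b%:R ^+ j
    = (Num.truncn (b%:R ^+ N * x))%:R / b%:R ^+ N :> R.
  elim: N => [|N IH].
    rewrite big_nil expr0 mul1r (_ : Num.truncn x = 0%N) ?mul0r//.
    by apply: truncn_def; rewrite x0.
  rewrite big_nat_recr//= IH truncn_digit// natrD natrM mulrDl; congr (_ + _).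
  by rewrite exprS invfM mulrA mulfK// gt_eqF.
have b1 : `|b%:R^-1 : R| < 1.
  by rewrite ger0_norm ?invr_ge0 ?ltW// invf_lt1// ltr1n.
have lim0 : (fun N => x - (b%:R^-1 : R) ^+ N) @ \oo --> x.
  rewrite -[X in _ --> X]subr0; apply: cvgB; first exact: cvg_cst.
  exact: cvg_expr b1.
apply: (squeeze_cvgr _ lim0 (cvg_cst x)); apply: nearW => N.
rewrite sE; have y0 : 0 <= b%:R ^+ N * x by rewrite mulr_ge0// ltW.
have /andP[l u] := truncn_itv y0; apply/andP; split.
  rewrite ler_pdivlMr// mulrBl exprVn mulVf ?gt_eqF// lerBlDr mulrC.
  by rewrite natr1 ltW.
by rewrite ler_pdivrMr// [leRHS]mulrC.
Qed.

Definition block_occurs (b : nat) (x : R) (k : nat) (d : k.-tuple 'I_b)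
    (n : nat) : bool :=
  [forall i : 'I_k, digit b x (n + i) == tnth d i].

Definition normal (b : nat) (x : R) : Prop :=
  forall (k : nat) (d : k.-tuple 'I_b), (1 <= k)%N ->
    (fun N : nat => (count (block_occurs x d) (iota 1 N))%:R / N%:R : R) @ \oo
      --> (b%:R ^- k : R).

Definition absolutely_nonnormal (x : R) : Prop :=
  forall b : nat, (2 <= b)%N -> ~ normal b x.

End digits.

Section fourier.
Variable R : realType.

(* expi t = e^{it} *)
Definition expi (t : R) : R[i] := cos t +i* sin t.

Definition cintegral (mu : probability (measurableTypeR R) R) (D : set R)
    (f : R -> R[i]) : R[i] :=
  Rintegral mu D (fun x => complex.Re (f x)) +i*
  Rintegral mu D (fun x => complex.Im (f x)).

Definition fourier_coef (mu : probability (measurableTypeR R) R) (n : int)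
    : R[i] :=
  cintegral mu `[0, 1[%classic (fun x => expi (- (2 * pi * n%:~R * x))).

End fourier.

(* Main.v *)
Require Import Defs.
From HB Require Import structures.
From mathcomp Require Import all_boot all_order all_algebra.
From mathcomp Require Import all_classical all_reals all_analysis.
From mathcomp Require Import complex ring lra zify measurable_realfun.
Import Order.TTheory GRing.Theory Num.Theory.
Import numFieldNormedType.Exports.
Local Open Scope classical_set_scope.
Local Open Scope ring_scope.
Local Open Scope complex_scope.

(* Start from a uniform point U of [0, 1) and move it infinitely often. Step k
   is assigned a base b_k, every base occurring infinitely often, and 2^k scales
   a = b_k^N, one for each index s in [2^k, 2^(k+1)), with N doubly exponential
   in s. The integer part of 2^k U selects one of these scales, and the current
   point is moved inside its cell [c/a, (c+1)/a) by the increasing affine map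
   onto the middle third of [c/a, c/a + a^-4): its b_k-ary digits of ranks N+1
   to 4N become 0. Later displacements are too small to destroy this, so the
   limit point has, in every base, infinitely many blocks of zeros filling three
   quarters of an initial segment, and is absolutely non-normal.
   A frequency t resonates with at most one scale index s. The scales much finer
   than 1/t do not change the phase, and the coarser ones cut the law into
   pieces on which it is an affine image of the previous law with a slope large
   compared to 1/t. Hence only the event that s is selected, of probability
   2^-k <= 2/s, contributes to the Fourier coefficient, and s is of the order of
   log log log t. *)

Set Implicit Arguments.
Unset Strict Implicit.
Unset Printing Implicit Defensive.

(** * Measurability and integrals of bounded functions *)

Section bounded_integrands.
Context d (T : measurableType d) (R : realType) (P : probability T R).

Implicit Types (D : set T) (X f : T -> R).

(** A preimage is a countable union over the values of [g]. This serves [squash] and [step], whose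
    formulas are elementary only once an integer part is fixed. *)
Lemma measurable_fun_cases (I : countType) (g : T -> I) (h : I -> T -> R) :
  (forall i, measurable (g @^-1` [set i])) ->
  (forall i, measurable_fun setT (h i)) ->
  measurable_fun setT (fun u => h (g u) u).
Proof.
move=> mg mh _ B mB; rewrite setTI.
rewrite (_ : _ @^-1` _ = \bigcup_i (g @^-1` [set i] `&` h i @^-1` B)).
  apply: countable_bigcupT_measurable => // i; apply: measurableI => //.
  by rewrite -[X in measurable X]setTI; exact: mh.
apply/seteqP; split => [u Bu|u [i _ [<-]]//]; by exists (g u).
Qed.

Lemma measurable_floor_eq (X : T -> R) (i : int) : measurable_fun setT X ->
  measurable ((fun u => Num.floor (X u)) @^-1` [set i]).
Proof.
move=> mX; rewrite (_ : _ @^-1` _ = X @^-1` `[i%:~R, (i + 1)%:~R[).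
  by rewrite -[X in measurable X]setTI; exact: mX.
apply/seteqP; split => u /=; rewrite in_itv/=.
  by move=> <-; exact: floor_itv.
exact: floor_def.
Qed.

Lemma measurable_truncn_eq (X : T -> R) (i : nat) : measurable_fun setT X ->
  measurable ((fun u => Num.truncn (X u)) @^-1` [set i]).
Proof.
move=> mX.
have mge (c : nat) : measurable [set u | (c <= Num.truncn (X u))%N].
  case: c => [|c].
    by rewrite (_ : [set _ | _] = setT)//; apply/seteqP; split.
  rewrite (_ : [set _ | _] = X @^-1` `[c.+1%:R, +oo[).
    by rewrite -[X in measurable X]setTI; exact: mX.
  apply/funext => u; apply/propext; rewrite /= in_itv/= andbT.
  have [X0|X0] := leP 0 (X u); first by rewrite truncn_ge_nat//.
  (* [truncn] is 0 on negative numbers, and these are also excluded by the threshold [c.+1], which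
     is at least 1. *)
  have -> : Num.truncn (X u) = 0%N.
    by apply/truncn0Pn; rewrite -ltNge (lt_trans X0).
  by split => // h; move: (lt_le_trans X0 (le_trans (ler0n R c.+1) h)); rewrite ltxx.
rewrite (_ : _ @^-1` _ = [set u | (i <= Num.truncn (X u))%N] `\`
    [set u | (i.+1 <= Num.truncn (X u))%N]); first exact: measurableD.
apply/seteqP; split => u /=; first by move=> ->; rewrite leqnn ltnn.
by move=> [h1 /negP h2]; apply/eqP; rewrite eqn_leq h1 andbT leqNgt.
Qed.

Lemma measurable_cosM (X : T -> R) t z : measurable_fun setT X ->
  measurable_fun setT (fun u => cos (t * X u + z)).
Proof.
move=> mX; apply: (measurableT_comp (f := @cos R)).
  by apply: continuous_measurable_fun; exact: continuous_cos.
by apply: measurable_funD => //; exact: measurable_funM.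
Qed.

Lemma integrable_bounded (D : set T) (f : T -> R) (M : R) : measurable D ->
  measurable_fun setT f -> (forall u, `|f u| <= M) ->
  P.-integrable D (EFin \o f).
Proof.
move=> mD mf fM; apply: measurable_bounded_integrable => //.
- by apply: le_lt_trans (probability_le1 P mD) _; rewrite ltry.
- exact: measurable_funTS.
- by exists M; split; [rewrite num_real|move=> y My u _ /=; rewrite (le_trans (fM u))// ltW].
Qed.

Lemma cos_norm_le1 (x : R) : `|cos x| <= 1.
Proof. by rewrite ler_norml cos_geN1 cos_le1. Qed.

Lemma integrable_cosM (D : set T) (X : T -> R) t z : measurable D ->
  measurable_fun setT X ->
  P.-integrable D (EFin \o (fun u => cos (t * X u + z))).
Proof.
move=> mD mX; apply: (@integrable_bounded _ _ 1) => //.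
- exact: measurable_cosM.
- by move=> u; exact: cos_norm_le1.
Qed.

Lemma Rintegral_norm_le (D : set T) (f : T -> R) (M : R) : measurable D ->
  P.-integrable D (EFin \o f) -> (forall u, D u -> `|f u| <= M) ->
  `|\int[P]_(u in D) f u| <= M * fine (P D).
Proof.
move=> mD fi fM; rewrite -(Rintegral_cst P mD).
apply: (le_trans (le_normr_Rintegral mD fi)).
apply: le_Rintegral => //; first exact: integrable_norm.
apply: measurable_bounded_integrable => //.
- by apply: le_lt_trans (probability_le1 P mD) _; rewrite ltry.
- by exists `|M|; split; [rewrite num_real|move=> y My u _ /=; rewrite ltW].
Qed.

(** Induction on [m]: split off the level set of the largest value of [g]; below it [g] takes one
    value fewer. *)
Lemma Rintegral_split (D : set T) (f : T -> R) (g : T -> nat) m : measurable D ->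
  P.-integrable D (EFin \o f) ->
  (forall i, measurable (D `&` g @^-1` [set i])) ->
  (forall u, D u -> (g u < m)%N) ->
  \int[P]_(u in D) f u = \sum_(i < m) \int[P]_(u in D `&` g @^-1` [set (i : nat)]) f u.
Proof.
move=> + + mg; elim: m D mg => [|m IH] D mg mD fi gm.
  rewrite big_ord0 (_ : D = set0) ?Rintegral_set0//.
  by apply/seteqP; split => // u /gm.
have DE : D = (D `&` ~` (g @^-1` [set m])) `|` (D `&` g @^-1` [set m]).
  by rewrite -setIUr setUC setUv setIT.
have mDm : measurable (D `&` ~` (g @^-1` [set m])).
  rewrite (_ : _ `&` _ = D `\` (D `&` g @^-1` [set m])); first exact: measurableD.
  by rewrite setDIr setDv set0U setDE.
rewrite big_ord_recr/= {1}DE Rintegral_setU//; last 2 first.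
- by rewrite -DE.
- by apply/disj_set2P; rewrite setIACA setICl setI0.
congr (_ + _).
rewrite (IH (D `&` ~` (g @^-1` [set m]))) => //.
- apply: eq_bigr => i _; congr (Rintegral _ _ _).
  apply/seteqP; split => u /=; first by move=> [[]].
  move=> [Du gi]; split => //; split=> //; rewrite gi.
  by apply/eqP; rewrite ltn_eqF.
- move=> i; rewrite setIAC; case: (eqVneq i m) => [->|im].
    by rewrite -setIA setICr setI0.
  rewrite (_ : _ `&` _ = D `&` g @^-1` [set i])//.
  apply/seteqP; split => u /=; first by move=> [[]].
  by move=> [Du gi]; split => //; rewrite gi; apply/eqP.
- by apply: integrableS fi => //; apply: subIsetl.
- by move=> u [Du /eqP gu]; rewrite ltn_neqAle gu/= -ltnS gm.
Qed.

End bounded_integrands.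

(** * The uniform law on [0, 1] *)

Section uniform.
Variable R : realType.
Local Notation mu := (@lebesgue_measure R).
Local Notation P := (uniform_prob (@ltr01 R)).
Local Notation T := (measurableTypeR R).

(** The density is 1 on [0, 1]; the nonnegative case is lifted through positive and negative
    parts. *)
Lemma uniform_integralE (D : set T) (f : T -> R) : measurable D ->
  D `<=` `[0, 1]%classic -> measurable_fun setT f ->
  (\int[P]_(u in D) (f u)%:E = \int[mu]_(u in D) (f u)%:E)%E.
Proof.
move=> mD D01 mf.
have key (g : T -> \bar R) : measurable_fun setT g -> (forall x, 0 <= g x)%E ->
    (\int[P]_(u in D) g u = \int[mu]_(u in D) g u)%E.
  move=> mg g0; rewrite integral_mkcond integral_uniform.
  - rewrite subr0 invr1 mul1e -integral_mkcondr.
    by rewrite (setIidr D01).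
  - by apply/(measurable_restrictT _ mD); exact: measurable_funTS.
  - by move=> x; rewrite patchE; case: ifP.
rewrite [LHS]integralE [RHS]integralE !key//.
- by apply: measurable_funeneg; exact/measurable_EFinP.
- by apply: measurable_funepos; exact/measurable_EFinP.
Qed.

Lemma uniform_probE (D : set T) : measurable D ->
  P D = mu (D `&` `[0, 1]%classic).
Proof.
move=> mD; have mD1 : measurable (D `&` `[0, 1]%classic) by exact: measurableI.
have -> : P D = (\int[P]_(u in D `&` `[0%R, 1%R]) (1%R)%:E)%E.
  rewrite -/(uniform_prob _ _) /uniform_prob integral_uniform_pdf.
  rewrite (uniform_integralE (f := fun=> 1))//.
  apply: eq_integral => u; rewrite inE/= => -[_]; rewrite in_itv/= => u01.
  by rewrite /uniform_pdf u01 subr0 invr1.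
by rewrite (uniform_integralE (f := fun=> 1))// integral_cst//= mul1e.
Qed.

Lemma uniform_prob01 : P `[0, 1[%classic = 1%E.
Proof.
rewrite uniform_probE// (_ : _ `&` _ = `[0, 1[%classic).
  by rewrite lebesgue_measure_itv/= lte_fin ltr01 oppr0 adde0.
by apply/setIidl => u /=; rewrite !in_itv/= => /andP[-> /ltW].
Qed.

(** Such a set meets [0, 1] at most in the point 1. *)
Lemma uniform_prob_null (D : set T) : measurable D ->
  (forall u, D u -> ~~ (0 <= u < 1)) -> P D = 0%E.
Proof.
move=> mD D0; rewrite uniform_probE//; apply/eqP; rewrite eq_le measure_ge0 andbT.
rewrite -(lebesgue_measure_set1 (1 : R)); apply: le_measure; rewrite ?inE//.
  exact: measurableI.
move=> u [/D0 u01 /=]; rewrite in_itv/= => /andP[u0 u1]; apply/eqP.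
by move: u01; rewrite u0 -leNgt eq_le u1 => ->.
Qed.

Lemma uniform_prob_le (l r : R) : l <= r -> (P `[l, r[%classic <= (r - l)%:E)%E.
Proof.
move=> lr; rewrite uniform_probE//.
apply: (@le_trans _ _ (mu `[l, r[%classic)).
  by apply: le_measure; rewrite ?inE//; exact: measurableI.
rewrite lebesgue_measure_itv/= lte_fin; case: ifP => _ //.
by rewrite lee_fin subr_ge0.
Qed.

(** The antiderivative sin(tu + z)/t varies by at most 2/t. This is where the constant 2 of the
    starting point U comes from. *)
Lemma Rintegral_cos_itv (l r t z : R) : 0 <= l -> r <= 1 -> 0 < t ->
  `|\int[P]_(u in `[l, r[) cos (t * u + z)| <= 2 / t.
Proof.
move=> l0 r1 t0; have [rl|lr] := leP r l.
  by rewrite set_itv_ge ?bnd_simp -?leNgt// Rintegral_set0 normr0 divr_ge0// ltW.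
have mf : measurable_fun setT (fun u : T => cos (t * u + z)) by exact: (@measurable_cosM _ T R id).
rewrite /Rintegral (uniform_integralE (f := fun u => cos (t * u + z))) => //; last first.
  by move=> u /=; rewrite !in_itv/= => /andP[lu ur]; apply/andP; split; lra.
rewrite integral_itv_bndo_bndc; last exact/measurable_EFinP/measurable_funTS.
pose F u : R := t^-1 * sin (t * u + z).
have dF x : is_derive (x : R) 1 F (cos (t * x + z)).
  rewrite /F; apply: is_derive_eq.
  by rewrite addr0 /GRing.scale/= mulr1; field; rewrite gt_eqF.
have cF : continuous F.
  by move=> x; apply: differentiable_continuous; apply/derivable1_diffP; case: (dF x).
have cc : continuous (fun u : T => cos (t * u + z)).
  move=> x; apply: continuous_comp; last exact: continuous_cos.
  by apply: cvgD; [apply: cvgM; [exact: cvg_cst|exact: cvg_id]|exact: cvg_cst].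
rewrite (@continuous_FTC2 _ _ F)//.
- rewrite /= /F -mulrBr normrM ger0_norm ?invr_ge0 ?(ltW t0)// mulrC.
  rewrite ler_wpM2r ?invr_ge0 ?(ltW t0)//.
  have := sin_le1 (t * r + z); have := sin_geN1 (t * r + z).
  have := sin_le1 (t * l + z); have := sin_geN1 (t * l + z).
  by move=> *; rewrite ler_norml; apply/andP; split; lra.
- exact: continuous_subspaceT.
- split => [x _||].
  + by case: (dF x).
  + by apply: cvg_at_right_filter; exact: cF.
  + by apply: cvg_at_left_filter; exact: cF.
- by move=> x _; rewrite derive1E; case: (dF x).
Qed.

End uniform.

(** * The map that moves a point inside its cell *)

Section squash.
Variable R : realType.

(* Only the middle third of the target interval is used: this leaves room for
   the later displacements. *)
Definition squash (a : nat) (x : R) : R :=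
  ((Num.floor (a%:R * x))%:~R
    + (1 + (a%:R * x - (Num.floor (a%:R * x))%:~R)) / (3 * a%:R ^+ 3)) / a%:R.

Lemma floor_truncn (x : R) : 0 <= x -> (Num.floor x)%:~R = (Num.truncn x)%:R :> R.
Proof.
move=> x0; rewrite (@floor_def _ x (Num.truncn x)%:Z)//.
by rewrite -[_ + 1]/((Num.truncn x + 1)%N%:Z) addn1; exact: truncn_itv.
Qed.

Lemma squash_affine (a : nat) (x : R) (c : R) : (0 < a)%N ->
  (Num.floor (a%:R * x))%:~R = c ->
  squash a x = x / (3 * a%:R ^+ 3) + (c / a%:R + (1 - c) / (3 * a%:R ^+ 4)).
Proof.
by move=> a0; rewrite /squash => ->; field; rewrite pnatr_eq0 -lt0n.
Qed.

Lemma squash_itv (a : nat) (x : R) : (0 < a)%N ->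
  (Num.floor (a%:R * x))%:~R + (3 * a%:R ^+ 3)^-1 <= a%:R * squash a x
    < (Num.floor (a%:R * x))%:~R + 2 / (3 * a%:R ^+ 3).
Proof.
move=> a0; set c := (Num.floor _)%:~R; have aR : 0 < a%:R :> R by rewrite ltr0n.
have /andP[] := floor_itv (a%:R * x); rewrite -/c intrD -/c => h1 h2.
have -> : a%:R * squash a x = c + (1 + (a%:R * x - c)) / (3 * a%:R ^+ 3).
  by rewrite /squash -/c mulrC divfK// gt_eqF.
have e0 : 0 < (3 * a%:R ^+ 3)^-1 :> R by rewrite invr_gt0 mulr_gt0// exprn_gt0.
move: e0; set e := _^-1 => e0; apply/andP; split; nra.
Qed.

Lemma squash_near (a : nat) (x : R) : (0 < a)%N -> `|squash a x - x| <= a%:R^-1.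
Proof.
move=> a0; have aR : 0 < a%:R :> R by rewrite ltr0n.
have a1 : 1 <= a%:R :> R by rewrite ler1n.
have /andP[] := floor_itv (a%:R * x); have /andP[] := @squash_itv a x a0.
rewrite intrD; set c := (Num.floor _)%:~R => h1 h2 h3 h4.
have e0 : 0 < (3 * a%:R ^+ 3)^-1 :> R by rewrite invr_gt0 mulr_gt0// exprn_gt0.
have e1 : (3 * a%:R ^+ 3)^-1 <= 3^-1 :> R.
  by rewrite lef_pV2 ?posrE ?mulr_gt0 ?exprn_gt0//; rewrite ler_peMr// exprn_ege1.
move: h1 h2 e0 e1; set e := _^-1 => h1 h2 e0 e1.
rewrite -(ler_pM2l aR) divff ?gt_eqF// -{1}(gtr0_norm aR) -normrM mulrBr.
rewrite ler_norml; apply/andP; split; lra.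
Qed.

(** As [a] is an integer, 1 is an endpoint of a cell, and [squash] does not leave the cell of
    [x]. *)
Lemma squash_itv01 (a : nat) (x : R) : (0 < a)%N -> 0 <= x < 1 -> 0 <= squash a x < 1.
Proof.
move=> a0 /andP[x0 x1]; have aR : 0 < a%:R :> R by rewrite ltr0n.
have a1 : 1 <= a%:R :> R by rewrite ler1n.
have ax0 : 0 <= a%:R * x by rewrite mulr_ge0// ltW.
have /andP[] := @squash_itv a x a0; rewrite floor_truncn//.
have : (Num.truncn (a%:R * x) < a)%N by rewrite truncn_lt_nat// gtr_pMr.
rewrite -(ltr_nat R) => h; have {h} : (Num.truncn (a%:R * x)).+1%:R <= a%:R :> R.
  by rewrite ler_nat -(ltr_nat R).
rewrite -natr1; set c := (Num.truncn _)%:R => h1 h2 h3.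
have c0 : 0 <= c by rewrite ler0n.
have e0 : 0 < (3 * a%:R ^+ 3)^-1 :> R by rewrite invr_gt0 mulr_gt0// exprn_gt0.
have e1 : (3 * a%:R ^+ 3)^-1 <= 3^-1 :> R.
  by rewrite lef_pV2 ?posrE ?mulr_gt0 ?exprn_gt0//; rewrite ler_peMr// exprn_ege1.
move: h2 h3 e0 e1; set e := _^-1 => h2 h3 e0 e1.
rewrite -(pmulr_rge0 _ aR) -(ltr_pM2l aR) mulr1; apply/andP; split; lra.
Qed.

Lemma cos_lipschitz (x y : R) : `|cos x - cos y| <= `|x - y|.
Proof.
wlog xy : x y / x <= y.
  move=> h; have [/h//|/ltW yx] := leP x y.
  by rewrite distrC (distrC x); exact: h.
have [c _ E] : exists2 c, c \in `[x, y]%R & cos y - cos x = - sin c * (y - x).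
  apply: (@MVT_segment _ cos (fun z => - sin z)) => //.
  by apply: continuous_subspaceT => z; exact: continuous_cos.
rewrite distrC E normrM normrN distrC ler_piMl//.
by rewrite ler_norml sin_geN1 sin_le1.
Qed.

End squash.

(** * Oscillatory integrals under one step *)

Section oscillation.
Context d (T : measurableType d) (R : realType) (P : probability T R).
Variable U : T -> R.
Hypothesis mU : measurable_fun setT U.
Implicit Types (X : T -> R) (V : R).

Definition box X (l r p q : R) : set T :=
  [set u | l <= U u < r /\ p <= X u < q].

Definition step (m : nat) (a : nat -> nat) X : T -> R :=
  fun u => squash (a (Num.truncn (m%:R * U u))) (X u).

(* Restricting to boxes makes the class of pairs (X, V) stable under the cutting
   into cells that is implied by [step]. *)
Definition osc X V := forall t z l r p q : R, 0 < t -> 0 <= l -> r <= 1 ->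
  `|\int[P]_(u in box X l r p q) cos (t * X u + z)| <= V / t.

Lemma measurable_itv_preimage X (l r : R) : measurable_fun setT X ->
  measurable [set u | l <= X u < r].
Proof.
move=> mX; rewrite (_ : [set u | _] = X @^-1` `[l, r[).
  by rewrite -[X in measurable X]setTI; exact: mX.
by apply/seteqP; split => u /=; rewrite in_itv.
Qed.

Lemma measurable_box X (l r p q : R) : measurable_fun setT X -> measurable (box X l r p q).
Proof.
by move=> mX; apply: measurableI; exact: measurable_itv_preimage.
Qed.

Lemma measurable_squash X a : measurable_fun setT X ->
  measurable_fun setT (fun u => squash a (X u)).
Proof.
move=> mX; have maX : measurable_fun setT (fun u => a%:R * X u).
  exact: measurable_funM.
rewrite /squash; apply: (@measurable_fun_cases _ T R _
  (fun u => Num.floor (a%:R * X u)) (fun i u => (i%:~R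
    + (1 + (a%:R * X u - i%:~R)) / (3 * a%:R ^+ 3)) / a%:R)).
  by move=> i; exact: measurable_floor_eq.
move=> i; apply: measurable_funM => //; apply: measurable_funD => //.
apply: measurable_funM => //; apply: measurable_funD => //.
exact: measurable_funB.
Qed.

Lemma measurable_step X m (a : nat -> nat) : measurable_fun setT X ->
  measurable_fun setT (step m a X).
Proof.
move=> mX; apply: (@measurable_fun_cases _ T R _
  (fun u => Num.truncn (m%:R * U u)) (fun j u => squash (a j) (X u))).
  by move=> i; apply: measurable_truncn_eq; exact: measurable_funM.
by move=> j; exact: measurable_squash.
Qed.

(** On each of the a cells the map is affine of slope 1/(3a^3), so the piece is a box integral of X
    at frequency t/(3a^3), at most 3a^3 V/t. Summing over the cells gives 3a^4 V/t. *)
Lemma osc_squash X V a : (0 < a)%N -> measurable_fun setT X ->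
  (forall u, 0 <= U u < 1 -> 0 <= X u < 1) -> osc X V ->
  osc (fun u => squash a (X u)) (3 * a%:R ^+ 4 * V).
Proof.
move=> a0 mX X01 oX t z l r p q t0 l0 r1.
have aR : 0 < a%:R :> R by rewrite ltr0n.
set D := box _ _ _ _ _; have mY := measurable_squash a mX.
have maX : measurable_fun setT (fun u => a%:R * X u) by exact: measurable_funM.
have mD : measurable D by exact: measurable_box.
have DX u : D u -> 0 <= X u < 1.
  by case=> /andP[lu ur] _; apply: X01; rewrite (le_trans l0 lu) (lt_le_trans ur).
rewrite (@Rintegral_split _ T R P D _ (fun u => Num.truncn (a%:R * X u)) a)//.
- have k0 : 0 < 3 * a%:R ^+ 3 :> R by rewrite mulr_gt0// exprn_gt0.
  apply: le_trans (ler_norm_sum _ _ _) _.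
  apply: (@le_trans _ _ (\sum_(i < a) V / (t / (3 * a%:R ^+ 3)))); last first.
    rewrite sumr_const card_ord -mulr_natl le_eqVlt; apply/orP; left; apply/eqP.
    by field; rewrite !gt_eqF.
  apply: ler_sum => c _.
  set k := c%:R / a%:R + (1 - c%:R) / (3 * a%:R ^+ 4) : R.
  have YE u : 0 <= a%:R * X u -> Num.truncn (a%:R * X u) = c ->
      squash a (X u) = X u / (3 * a%:R ^+ 3) + k.
    by move=> aX0 uc; rewrite (@squash_affine _ _ _ c%:R)// floor_truncn// uc.
  (* On cell c, bounds on the squashed value pull back through the affine map to bounds on X, so the
     piece is again a box. *)
  have -> : D `&` (fun u => Num.truncn (a%:R * X u)) @^-1` [set (c : nat)]
    = box X l r (Num.max (c%:R / a%:R) ((p - k) * (3 * a%:R ^+ 3)))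
                (Num.min (c.+1%:R / a%:R) ((q - k) * (3 * a%:R ^+ 3))).
    apply/seteqP; split => u.
      move=> [Du /= uc]; have /andP[Xu0 Xu1] := DX _ Du.
      have aX0 : 0 <= a%:R * X u by rewrite mulr_ge0// ltW.
      have [Du1 Du2] := Du; split=> //; move: Du2; rewrite YE// => /andP[pu uq].
      have /andP[] := truncn_itv aX0; rewrite uc => h1 h2.
      rewrite ge_max lt_min -!andbA; apply/and4P; split.
      + by rewrite ler_pdivrMr// mulrC.
      + by rewrite -ler_pdivlMr// lerBlDr.
      + by rewrite ltr_pdivlMr// mulrC.
      + by rewrite -ltr_pdivrMr// ltrBrDr.
    move=> [Du1]; rewrite ge_max lt_min -!andbA => /and4P[h1 h2 h3 h4].
    have Xu0 : 0 <= X u by apply: le_trans h1; rewrite divr_ge0// ltW.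
    have aX0 : 0 <= a%:R * X u by rewrite mulr_ge0// ltW.
    have uc : Num.truncn (a%:R * X u) = c.
      apply: truncn_def; move: h1 h3; rewrite ler_pdivrMr// ltr_pdivlMr//.
      by rewrite mulrC => -> ->.
    split=> //; split=> //; rewrite YE//; apply/andP; split.
      by rewrite -lerBlDr ler_pdivlMr.
    by rewrite -ltrBrDr ltr_pdivrMr.
  rewrite (@eq_Rintegral _ _ _ _ _
      (fun u => cos (t / (3 * a%:R ^+ 3) * X u + (t * k + z)))).
    by apply: oX => //; rewrite divr_gt0.
  move=> u; rewrite inE => -[_]; rewrite ge_max lt_min -!andbA.
  move=> /and4P[h1 _ h3 _]; congr cos.
  have Xu0 : 0 <= X u by apply: le_trans h1; rewrite divr_ge0// ltW.
  rewrite YE//; first by ring.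
    by rewrite mulr_ge0// ltW.
  apply: truncn_def; move: h1 h3; rewrite ler_pdivrMr// ltr_pdivlMr//.
  by rewrite mulrC => -> ->.
- exact: integrable_cosM.
- by move=> i; apply: measurableI => //; exact: measurable_truncn_eq.
- move=> u /DX /andP[x0 x1]; rewrite truncn_lt_nat ?gtr_pMr//.
  by rewrite mulr_ge0// ltW.
Qed.

Lemma box_truncn X (m j : nat) (l r p q : R) : (0 < m)%N -> 0 <= l ->
  box X l r p q `&` (fun u => Num.truncn (m%:R * U u)) @^-1` [set j]
  = box X (Num.max l (j%:R / m%:R)) (Num.min r (j.+1%:R / m%:R)) p q.
Proof.
move=> m0 l0; have mR : 0 < m%:R :> R by rewrite ltr0n.
apply/seteqP; split => u; rewrite /box /=.
  move=> [[/andP[lu ur] Xu] uj]; split => //; rewrite ge_max lt_min lu ur/=.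
  have mu0 : 0 <= m%:R * U u by rewrite mulr_ge0 ?(le_trans l0 lu)// ltW.
  have /andP[] := truncn_itv mu0; rewrite uj => h1 h2.
  by rewrite ler_pdivrMr// ltr_pdivlMr// ![U u * _]mulrC h1.
rewrite ge_max lt_min -!andbA => -[/and4P[lu ju ur uj] Xu].
rewrite lu ur; split=> //; apply: truncn_def.
by move: ju uj; rewrite ler_pdivrMr// ltr_pdivlMr// ![U u * _]mulrC => -> ->.
Qed.

Lemma osc_split X (m : nat) (a : nat -> nat) (t z l r p q : R) : (0 < m)%N ->
  0 <= l -> r <= 1 -> measurable_fun setT X ->
  `|\int[P]_(u in box (step m a X) l r p q) cos (t * step m a X u + z)| <=
  \sum_(j < m) `|\int[P]_(u in
     box (fun u => squash (a j) (X u)) (Num.max l (j%:R / m%:R))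
        (Num.min r (j.+1%:R / m%:R)) p q) cos (t * squash (a j) (X u) + z)|.
Proof.
move=> m0 l0 r1 mX; set Y := step m a X; have mR : 0 < m%:R :> R by rewrite ltr0n.
have mY : measurable_fun setT Y by exact: measurable_step.
have mD : measurable (box Y l r p q) by exact: measurable_box.
rewrite (@Rintegral_split _ T R P _ _ (fun u => Num.truncn (m%:R * U u)) m)//.
- apply: le_trans (ler_norm_sum _ _ _) _; apply: ler_sum => j _.
  have E : box Y l r p q `&` (fun u => Num.truncn (m%:R * U u)) @^-1` [set (j : nat)]
     = box (fun u => squash (a j) (X u)) l r p q `&`
       (fun u => Num.truncn (m%:R * U u)) @^-1` [set (j : nat)].
    apply/seteqP; split => u [[h1 h2] /= uj]; split => //; split => //; move: h2;
      by rewrite /Y /step uj.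
  rewrite -box_truncn// -E.
  rewrite (@eq_Rintegral _ _ _ _ _ (fun u => cos (t * squash (a j) (X u) + z)))//.
  by move=> u; rewrite inE/= => -[_ uj]; rewrite /Y /step uj.
- exact: integrable_cosM.
- move=> i; apply: measurableI => //; apply: measurable_truncn_eq.
  exact: measurable_funM.
- move=> u [/andP[lu ur] _]; rewrite truncn_lt_nat ?gtr_pMr ?(lt_le_trans ur)//.
  by rewrite mulr_ge0 ?(le_trans l0 lu)// ltW.
Qed.

Lemma osc_step X V (m : nat) (a : nat -> nat) : (0 < m)%N ->
  (forall j, 0 < a j)%N -> measurable_fun setT X ->
  (forall u, 0 <= U u < 1 -> 0 <= X u < 1) -> osc X V ->
  osc (step m a X) (\sum_(j < m) 3 * (a j)%:R ^+ 4 * V).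
Proof.
move=> m0 a0 mX X01 oX t z l r p q t0 l0 r1.
apply: le_trans; first exact: osc_split.
rewrite mulr_suml; apply: ler_sum => j _.
apply: (osc_squash (a0 j) mX X01 oX) => //; first by rewrite le_max l0.
by rewrite ge_min r1.
Qed.

Hypothesis PU : forall l r : R, 0 <= l -> l <= r -> r <= 1 ->
  fine (P [set u | l <= U u < r]) <= r - l.

(* [j0] is the resonant scale, the only one for which nothing is assumed. *)
Lemma decay_step X V (m : nat) (a : nat -> nat) (j0 : nat) (e t z : R) :
  (0 < m)%N -> (forall j, 0 < a j)%N -> measurable_fun setT X ->
  (forall u, 0 <= U u < 1 -> 0 <= X u < 1) -> osc X V -> 0 < t -> 0 <= e ->
  (forall j, (j < m)%N -> j != j0 -> 3 * (a j)%:R ^+ 4 * V / t <= e \/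
    V / t + t / (a j)%:R / m%:R <= e) ->
  `|\int[P]_(u in [set u | 0 <= U u < 1]) cos (t * step m a X u + z)| <=
  m%:R^-1 + m%:R * e.
Proof.
move=> m0 a0 mX X01 oX t0 e0 He; set Y := step m a X; have mR : 0 < m%:R :> R by rewrite ltr0n.
have mY : measurable_fun setT Y by exact: measurable_step.
have Y01 u : 0 <= U u < 1 -> 0 <= Y u < 1.
  by move=> /X01; exact: squash_itv01.
have -> : [set u | 0 <= U u < 1] = box Y 0 1 0 1.
  by apply/seteqP; split => u /=; [move=> ?; split=> //; exact: Y01|case].
apply: le_trans; first exact: osc_split.
apply: (@le_trans _ _ (\sum_(j < m) ((if (j : nat) == j0 then m%:R^-1 else 0) + e))).
  apply: ler_sum => j _; set l := Num.max _ _; set r := Num.min _ _.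
  have jm0 : 0 <= j%:R / m%:R :> R by rewrite divr_ge0// ltW.
  have jm1 : j.+1%:R / m%:R <= 1 :> R by rewrite ler_pdivrMr// mul1r ler_nat.
  have lE : l = j%:R / m%:R by apply/max_r.
  have rE : r = j.+1%:R / m%:R by apply/min_r.
  have rl : r - l = m%:R^-1 by rewrite lE rE -mulrBl -natrB ?subSnn ?mul1r// leqnSn.
  have lr : l <= r by rewrite -subr_ge0 rl invr_ge0 ltW.
  have l0 : 0 <= l by rewrite lE.
  have r1 : r <= 1 by rewrite rE.
  (* Resonant scale: bound the cosine by 1 and keep only the probability 1/m of the selection. *)
  have [jj|jj] := ifPn.
    have mD : measurable (box (fun u => squash (a j) (X u)) l r 0 1).
      by apply: measurable_box; exact: measurable_squash.
    apply: le_trans (_ : fine (P (box (fun u => squash (a j) (X u)) l r 0 1)) <= _).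
      rewrite -[leRHS]mul1r; apply: Rintegral_norm_le => //.
        by apply: integrable_cosM => //; exact: measurable_squash.
      by move=> u _; exact: cos_norm_le1.
    apply: (@le_trans _ _ (fine (P [set u | l <= U u < r]))).
      apply: fine_le; rewrite ?fin_num_measure//; first exact: measurable_itv_preimage.
      apply: le_measure; rewrite ?inE//; first exact: measurable_itv_preimage.
      by move=> u [].
    by apply: le_trans (PU l0 lr r1) _; rewrite rl lerDl.
  (* Coarse scale: [osc_squash] suffices. Fine scale: undoing the move changes the cosine by at most
     t/a, on an event of probability at most 1/m, and [osc] applies to X itself. *)
  rewrite add0r; have [h|h] := He j (ltn_ord j) jj.
    apply: le_trans h.
    by apply: (osc_squash (a0 j) mX X01 oX) => //.
  apply: le_trans h; have ajR : 0 < (a j)%:R :> R by rewrite ltr0n.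
  (* Values stay in [0, 1) before and after the move, so with the range [0, 1) both boxes constrain
     only U. *)
  have bE : box (fun u => squash (a j) (X u)) l r 0 1 = box X l r 0 1.
    apply/seteqP; split => u [/andP[lu ur] _].
      by split; rewrite ?lu// X01// (le_trans l0 lu) (lt_le_trans ur).
    by split; rewrite ?lu//; apply: squash_itv01 => //; apply: X01;
      rewrite (le_trans l0 lu) (lt_le_trans ur).
  rewrite bE; set D := box _ _ _ _ _.
  have mD : measurable D by exact: measurable_box.
  rewrite -[X in `|X|](subrK (\int[P]_(u in D) cos (t * X u + z))) addrC.
  apply: le_trans (ler_normD _ _) _; apply: lerD; first exact: oX.
  rewrite -RintegralB//; last 2 first.
  - by apply: integrable_cosM => //; exact: measurable_squash.
  - exact: integrable_cosM.
  apply: le_trans (_ : t / (a j)%:R * fine (P D) <= _).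
    apply: Rintegral_norm_le => //.
      apply: (@integrable_bounded _ _ _ _ _ _ (1 + 1)) => //.
        by apply: measurable_funB; apply: measurable_cosM => //; exact: measurable_squash.
      move=> u; apply: le_trans (ler_normB _ _) _.
      by apply: lerD; exact: cos_norm_le1.
    move=> u _; apply: le_trans (cos_lipschitz _ _) _.
    rewrite (_ : _ - _ = t * (squash (a j) (X u) - X u)); last by ring.
    by rewrite normrM gtr0_norm// ler_pM2l//; exact: squash_near.
  rewrite ler_pM2l ?divr_gt0//.
  apply: (@le_trans _ _ (fine (P [set u | l <= U u < r]))).
    apply: fine_le; rewrite ?fin_num_measure//; first exact: measurable_itv_preimage.
    apply: le_measure; rewrite ?inE//; first exact: measurable_itv_preimage.
    by move=> u [].
  by apply: le_trans (PU l0 lr r1) _; rewrite rl.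
rewrite big_split/= sumr_const card_ord -[X in _ + X]mulr_natl lerD2r.
rewrite -big_mkcond/=; have [jm|jm] := ltnP j0 m.
  by rewrite (big_pred1 (Ordinal jm)).
by rewrite big_pred0 ?invr_ge0 ?ltW// => j; rewrite ltn_eqF// (leq_trans (ltn_ord j)).
Qed.

End oscillation.

(** * Arithmetic of the scales *)

Definition expo (s : nat) : nat := (2 ^ (2 ^ (s + 2)))%N.

Lemma expoS s : expo s.+1 = (expo s * expo s)%N.
Proof. by rewrite /expo addSn expnS mul2n -addnn expnD. Qed.

(** With [expoS] this gives expo (s + 1) >= (8s + 16) expo s, which absorbs every exponent of the
    form 4s expo s plus lower terms met below. The shift by 2 in [expo] makes it true from s = 1. *)
Lemma expo_ge s : (1 <= s)%N -> (8 * s + 16 <= expo s)%N.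
Proof.
elim: s => // -[|s] IH _; first by [].
by have := IH isT; rewrite (expoS s.+1); move: (expo _) => E; nia.
Qed.

Lemma expo_gt0 s : (0 < expo s)%N.
Proof. by rewrite expn_gt0. Qed.

Lemma expo_homo (r s : nat) : (r <= s)%N -> (expo r <= expo s)%N.
Proof. by move=> rs; rewrite !leq_exp2l// leq_add2r. Qed.

Lemma expo_sub_homo (r s : nat) : (1 <= r)%N -> (r <= s)%N ->
  (expo r - r <= expo s - s)%N.
Proof.
move=> r1; elim: s => [|s IH]; first by rewrite leqn0 => /eqP ->.
rewrite leq_eqVlt => /predU1P[->//|rs]; apply: leq_trans (IH rs) _.
have := @expo_ge s (leq_trans r1 rs).
by rewrite expoS; move: (expo s) => E; nia.
Qed.

(* [k |-> logn 2 k] takes each value infinitely often. *)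
Definition base (k : nat) : nat := (logn 2 k + 2)%N.

Definition scale (k j : nat) : nat := (base k ^ expo (2 ^ k + j))%N.

Lemma base_ge2 k : (2 <= base k)%N.
Proof. by rewrite leq_addl. Qed.

Lemma base_le k : (base k <= 2 ^ (2 ^ k))%N.
Proof.
have lk : (logn 2 k <= k)%N.
  by case: k => // k; rewrite ltnW// ltn_logl.
apply: (@leq_trans (k + 2)); first by rewrite leq_add2r.
elim: k {lk} => // k IH; have := IH; have := ltn_expl (2 ^ k) (isT : 1 < 2)%N.
by rewrite expnS mul2n -addnn expnD; move: (2 ^ (2 ^ k))%N => E; nia.
Qed.

Lemma scale_gt0 k j : (0 < scale k j)%N.
Proof. by rewrite expn_gt0 (leq_trans _ (base_ge2 k)). Qed.

Lemma scale_ge k j : (2 ^ expo (2 ^ k + j) <= scale k j)%N.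
Proof. by rewrite leq_exp2r ?base_ge2// expo_gt0. Qed.

Lemma scale_le k j : (scale k j <= 2 ^ ((2 ^ k + j) * expo (2 ^ k + j)))%N.
Proof.
apply: (@leq_trans (2 ^ (2 ^ k * expo (2 ^ k + j)))%N).
  by rewrite expnM leq_exp2r ?base_le// expo_gt0.
by rewrite leq_exp2l// leq_pmul2r ?leq_addr// expo_gt0.
Qed.

(** Bounds the factor lost in [osc_squash]: 3 <= 2^2, and the base is absorbed by the factor r in
    the exponent. *)
Lemma scale4_le k j r : (2 ^ k + j <= r)%N ->
  (3 * scale k j ^ 4 <= 2 ^ (2 + 4 * r * expo r))%N.
Proof.
move=> kr; rewrite expnD leq_mul//.
apply: leq_trans (_ : (2 ^ (r * expo r)) ^ 4 <= _)%N; last first.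
  by rewrite -expnM leq_exp2l//; lia.
rewrite leq_exp2r//; apply: leq_trans (scale_le k j) _.
by rewrite leq_exp2l// leq_mul// expo_homo.
Qed.

(** The [osc] constant of the k-th point of the walk. The reserve 3 * 2^k in the exponent pays, in
    [limit_decay], for a factor 2^(2k) and for the term subtracted in the frequency threshold. *)
Definition oscb (k : nat) : nat := (2 ^ (expo (2 ^ k) - 3 * 2 ^ k))%N.

(** For scales of index below r + 1: from the frequency 2^(expo (r + 1) - (r + 1)) on, the bound of
    [osc_squash] is at most 2^(-2k). *)
Lemma oscb_step k j r : (j < 2 ^ k)%N -> (2 ^ k + j <= r)%N ->
  (2 ^ (k + k) * (3 * scale k j ^ 4) * oscb k <= 2 ^ (expo r.+1 - r.+1))%N.
Proof.
move=> jk kr; have k2 := ltn_expl k (isT : 1 < 2)%N.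
apply: (@leq_trans (2 ^ (k + k) * 2 ^ (2 + 4 * r * expo r) * oscb k)).
  by rewrite leq_mul// leq_mul// scale4_le.
rewrite -!expnD leq_exp2l//.
have r1 : (1 <= r)%N by lia.
have := expo_ge r1; rewrite expoS.
have : (expo (2 ^ k) <= expo r)%N by apply: expo_homo; lia.
by move: (expo (2 ^ k)) (expo r) (2 ^ k)%N kr k2 {jk} => E' E K; nia.
Qed.

(** The induction step of [osc_walk]: every index is at most r = 2^(k+1) - 1, and expo (r + 1)
    dominates the exponent of the whole sum. *)
Lemma sum_oscb k :
  (\sum_(j < 2 ^ k) 3 * scale k j ^ 4 * oscb k <= oscb k.+1)%N.
Proof.
have k2 := ltn_expl k (isT : 1 < 2)%N; set r := (2 ^ k + 2 ^ k).-1.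
have rE : r.+1 = (2 ^ k.+1)%N by rewrite /r expnS; lia.
apply: (@leq_trans (\sum_(j < 2 ^ k) 2 ^ (2 + 4 * r * expo r) * oscb k)).
  apply: leq_sum => j _; rewrite leq_mul// scale4_le//.
  by have := ltn_ord j; rewrite /r; lia.
rewrite sum_nat_const card_ord -!expnD leq_exp2l// -rE.
have r1 : (1 <= r)%N by rewrite /r; lia.
have := expo_ge r1; rewrite expoS.
have : (expo (2 ^ k) <= expo r)%N by apply: expo_homo; rewrite /r; lia.
have : (2 ^ k <= r)%N by rewrite /r; lia.
by move: (expo (2 ^ k)) (expo r) (2 ^ k)%N k2 {rE} => E' E K; nia.
Qed.

(** Says that [radius k.+1] is at most 1/(3a^4), the margin left on either side of the middle
    third. *)
Lemma scale_tail k j : (j < 2 ^ k)%N ->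
  (6 * scale k j ^ 4 <= 2 ^ expo (2 ^ k.+1))%N.
Proof.
move=> jk; set r := (2 ^ k + j)%N.
apply: (@leq_trans (2 * 2 ^ (2 + 4 * r * expo r))).
  by rewrite (_ : 6 = 2 * 3)%N// -mulnA leq_mul// scale4_le.
rewrite -expnS leq_exp2l//.
apply: (@leq_trans (expo r.+1)); last first.
  by apply: expo_homo; rewrite /r expnS; lia.
have r1 : (1 <= r)%N by rewrite /r; have := expn_gt0 2 k; lia.
by have := expo_ge r1; rewrite expoS; move: (expo r) => E; nia.
Qed.

Lemma expo_double k : (2 * 2 ^ expo (2 ^ k) <= 2 ^ expo (2 ^ k.+1))%N.
Proof.
rewrite -expnS leq_exp2l//; apply: (@leq_trans (expo (2 ^ k).+1)); last first.
  by apply: expo_homo; rewrite expnS; have := expn_gt0 2 k; lia.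
have k1 : (1 <= 2 ^ k)%N by rewrite expn_gt0.
by have := expo_ge k1; rewrite expoS; move: (expo _) => E; nia.
Qed.

(** * The sequence of displacements, its limit and the decay estimate *)

Section walk.
Context d (T : measurableType d) (R : realType) (P : probability T R).
Variable U : T -> R.
Hypothesis mU : measurable_fun setT U.

(* The scales selected at different steps are not independent: only the
   probability of each selection matters. *)
Fixpoint walk (k : nat) : T -> R :=
  if k is k'.+1 then step U (2 ^ k')%N (scale k') (walk k') else U.

(** Bounds the sum of all displacements from step k on: step k moves a point by at most half of it,
    and it at least halves at each step. *)
Definition radius (k : nat) : R := 2 / (2 ^ expo (2 ^ k))%N%:R.

Lemma measurable_walk k : measurable_fun setT (walk k).
Proof. by elim: k => //= k IH; exact: measurable_step. Qed.

Lemma walk_itv k u : 0 <= U u < 1 -> 0 <= walk k u < 1.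
Proof. by move=> U01; elim: k => //= k IH; exact: squash_itv01 (scale_gt0 _ _) IH. Qed.

Lemma radius_gt0 k : 0 < radius k.
Proof. by rewrite divr_gt0// ltr0n expn_gt0. Qed.

Lemma radiusS k : radius k.+1 <= radius k / 2.
Proof.
rewrite /radius ler_pdivrMr ?ltr0n ?expn_gt0//.
have : (2 * 2 ^ expo (2 ^ k))%N%:R <= (2 ^ expo (2 ^ k.+1))%N%:R :> R.
  by rewrite ler_nat expo_double.
have : 0 < (2 ^ expo (2 ^ k))%N%:R :> R by rewrite ltr0n expn_gt0.
rewrite natrM; move: (2 ^ expo (2 ^ k))%N%:R (2 ^ expo (2 ^ k.+1))%N%:R => a b a0 ab.
rewrite [leRHS](_ : _ = b / a); last by field; rewrite gt_eqF.
by rewrite ler_pdivlMr.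
Qed.

Lemma walkS_near k u : `|walk k.+1 u - walk k u| <= radius k - radius k.+1.
Proof.
apply: (@le_trans _ _ (radius k / 2)); last by have := radiusS k; lra.
rewrite /=; apply: le_trans (squash_near _ (scale_gt0 _ _)) _.
rewrite /radius mulrAC divff// mul1r lef_pV2 ?posrE ?ltr0n ?scale_gt0 ?expn_gt0//.
rewrite ler_nat; apply: leq_trans (scale_ge _ _).
by rewrite leq_exp2l// expo_homo// leq_addr.
Qed.

Lemma walk_near k n u : (k <= n)%N -> `|walk n u - walk k u| <= radius k - radius n.
Proof.
elim: n => [|n IH]; first by rewrite leqn0 => /eqP ->; rewrite !subrr normr0.
rewrite leq_eqVlt => /predU1P[->|/IH kn]; first by rewrite !subrr normr0.
have := ler_normD (walk n.+1 u - walk n u) (walk n u - walk k u).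
by rewrite subrKA; have := walkS_near n u; lra.
Qed.

Lemma radius_cvg0 : radius k @[k --> \oo] --> 0.
Proof.
have h : (fun k => 2 * harmonic k) @ \oo --> (0 : R).
  by rewrite -[X in _ --> X](mulr0 2); apply: cvgM; [exact: cvg_cst|exact: cvg_harmonic].
apply: (squeeze_cvgr _ (cvg_cst 0) h); apply: nearW => k.
rewrite ltW ?radius_gt0//= /radius ler_pM2l// lef_pV2 ?posrE ?ltr0n ?expn_gt0//.
rewrite ler_nat; apply: (leq_trans (ltn_expl k (isT : 1 < 2)%N)).
apply: (leq_trans (ltnW (ltn_expl _ (isT : 1 < 2)%N))); rewrite leq_exp2l//.
have k1 : (1 <= 2 ^ k)%N by rewrite expn_gt0.
by have := expo_ge k1; lia.
Qed.

Definition limit (u : T) : R := lim (walk k u @[k --> \oo]).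

Lemma walk_cvg u : walk k u @[k --> \oo] --> limit u.
Proof.
(* By [walkS_near], subtracting the radius makes the sequence nondecreasing, and it stays
   bounded. *)
pose w k := walk k u - radius k.
have cw : cvgn w.
  apply: nondecreasing_is_cvgn.
    apply/nondecreasing_seqP => k; rewrite /w.
    by have := walkS_near k u; rewrite ler_norml; lra.
  exists (walk 0 u + radius 0) => _ [k _ <-]; rewrite /w.
  have := walk_near u (leq0n k); have := radius_gt0 k.
  by rewrite ler_norml; lra.
have : cvgn (fun k => w k + radius k).
  by apply: is_cvgD => //; apply/cvg_ex; exists 0; exact: radius_cvg0.
by rewrite (_ : (fun k => _) = walk ^~ u)//; apply/funext => k; rewrite /w subrK.
Qed.

Lemma measurable_limit : measurable_fun setT limit.
Proof.
apply: (measurable_fun_cvg (h := walk)).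
  by move=> k; exact: measurable_walk.
by move=> u _; exact: walk_cvg.
Qed.

Lemma limit_near k u : `|limit u - walk k u| <= radius k.
Proof.
have : `|walk n u - walk k u| @[n --> \oo] --> `|limit u - walk k u|.
  by apply: cvg_norm; apply: cvgB; [exact: walk_cvg|exact: cvg_cst].
move=> h; rewrite -(cvg_lim _ h)//; apply: limr_le; first by apply/cvg_ex; eexists; exact: h.
near=> n; have kn : (k <= n)%N by near: n; exact: nbhs_infty_ge.
by apply: le_trans (walk_near u kn) _; rewrite lerBlDr lerDl ltW// radius_gt0.
Unshelve. all: by end_near. Qed.

(** Here j is the scale selected at step k and c the cell of the current point. Step k puts the
    point into the middle third, and the later displacements do not exceed the margin on either
    side. *)
Lemma limit_block k u : 0 <= U u < 1 -> exists (j c : nat),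
  [/\ (j < 2 ^ k)%N, (c < scale k j)%N &
      c%:R <= (scale k j)%:R * limit u < c%:R + ((scale k j)%:R ^+ 3)^-1].
Proof.
move=> U01; set j := Num.truncn ((2 ^ k)%N%:R * U u).
have [U0 U1] := andP U01; have k2 : 0 < (2 ^ k)%N%:R :> R by rewrite ltr0n expn_gt0.
have jk : (j < 2 ^ k)%N by rewrite truncn_lt_nat ?gtr_pMr// mulr_ge0// ltW.
set a := scale k j; have a0 : (0 < a)%N := scale_gt0 k j.
have aR : 0 < a%:R :> R by rewrite ltr0n.
have [x0 x1] := andP (walk_itv k U01).
have ax0 : 0 <= a%:R * walk k u by rewrite mulr_ge0// ltW.
exists j, (Num.truncn (a%:R * walk k u)); split => //.
  by rewrite truncn_lt_nat// gtr_pMr.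
have /andP[] := squash_itv (walk k u) a0; rewrite floor_truncn//.
rewrite -[squash a _]/(walk k.+1 u); set c := (Num.truncn _)%:R => h1 h2.
have : a%:R * `|limit u - walk k.+1 u| <= (3 * a%:R ^+ 3)^-1.
  apply: le_trans (_ : a%:R * radius k.+1 <= _); first by rewrite ler_pM2l// limit_near.
  rewrite /radius; set b := (2 ^ _)%N%:R.
  have b0 : 0 < b by rewrite ltr0n expn_gt0.
  have : (6 * a ^ 4)%N%:R <= b by rewrite ler_nat scale_tail.
  rewrite natrM natrX => ab.
  rewrite mulrA ler_pdivrMr// ler_pdivlMl ?mulr_gt0 ?exprn_gt0//.
  by apply: le_trans ab; rewrite le_eqVlt; apply/orP; left; apply/eqP; ring.
have e3 : (a%:R ^+ 3)^-1 = 3 * (3 * a%:R ^+ 3)^-1 :> R by field; rewrite gt_eqF.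
rewrite e3 -{1}(gtr0_norm aR) -normrM mulrBr ler_norml => /andP[h3 h4].
move: h1 h2 h3 h4; set e := _^-1 => h1 h2 h3 h4; apply/andP; split; lra.
Qed.

(** The strict upper bound could be lost in the limit of the walk; it comes from the block of step
    0, which ends at or before (c + 1)/a <= 1. *)
Lemma limit_itv u : 0 <= U u < 1 -> 0 <= limit u < 1.
Proof.
move=> /(limit_block 0)[j [c [_ ca /andP[h1 h2]]]].
have a0 := scale_gt0 0 j; move: h1 h2 a0 ca; set a := scale 0 j => h1 h2 a0 ca.
have aR : 0 < a%:R :> R by rewrite ltr0n.
have c1 : c%:R + 1 <= a%:R :> R by rewrite natr1 ler_nat.
have a1 : (a%:R ^+ 3)^-1 <= 1 :> R.
  by rewrite invf_le1 ?exprn_gt0// exprn_ege1// ler1n.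
rewrite -(pmulr_rge0 _ aR) -(ltr_pM2l aR) mulr1.
by have := ler0n R c; move=> c0; apply/andP; split; lra.
Qed.

Hypothesis PU : forall l r : R, 0 <= l -> l <= r -> r <= 1 ->
  fine (P [set u | l <= U u < r]) <= r - l.
Hypothesis oU : osc P U U 2.

Lemma osc_walk k : osc P U (walk k) (oscb k)%:R.
Proof.
have mono X (V V' : R) : V <= V' -> osc P U X V -> osc P U X V'.
  move=> VV h t z l r p q t0 l0 r1; apply: le_trans (h t z l r p q t0 l0 r1) _.
  by rewrite ler_pM2r ?invr_gt0.
elim: k => [|k IH].
  apply: mono oU; rewrite ler_nat /oscb -{1}(expn1 2) leq_exp2l//.
apply: mono (osc_step (V := (oscb k)%:R) _ _ _ _ _ IH) => //.
- apply: le_trans (_ : (\sum_(j < 2 ^ k) 3 * scale k j ^ 4 * oscb k)%N%:R <= _); last first.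
    by rewrite ler_nat sum_oscb.
  by rewrite natr_sum; apply: ler_sum => j _; rewrite !natrM natrX.
- by rewrite expn_gt0.
- by move=> j; exact: scale_gt0.
- exact: measurable_walk.
- by move=> u; exact: walk_itv.
Qed.

(** The resonant scale has index s, hence belongs to the step k with 2^k <= s < 2^(k+1). Earlier
    steps enter through [osc_walk], step k through [decay_step], later ones through [radius]. *)
Lemma limit_decay (s : nat) (t z : R) : (1 <= s)%N ->
  (2 ^ (expo s - s))%N%:R <= t < (2 ^ (expo s.+1 - s.+1))%N%:R ->
  `|\int[P]_(u in [set u | 0 <= U u < 1]) cos (t * limit u + z)| <= 8 / s%:R.
Proof.
move=> s1 /andP[ts tS]; have t0 : 0 < t by apply: lt_le_trans ts; rewrite ltr0n expn_gt0.
set k := trunc_log 2 s; have /andP[ks sk] := trunc_log_bounds (isT : 1 < 2)%N s1.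
rewrite -/k in ks sk; have k1 : (1 <= 2 ^ k)%N by rewrite expn_gt0.
have mR : 0 < (2 ^ k)%N%:R :> R by rewrite ltr0n.
set D := [set u | _].
have mD : measurable D by exact: measurable_itv_preimage.
have mW := measurable_walk k.+1; have mL := measurable_limit.
have step_bound : `|\int[P]_(u in D) cos (t * walk k.+1 u + z)| <= 3 / (2 ^ k)%N%:R.
  (* Each of the 2^k non-resonant scales may cost 2^(-2k) twice: once for the oscillation of the
     previous point, once for the change of phase. *)
  set e := 2 / (2 ^ (k + k))%N%:R : R.
  have e0 : 0 < e by rewrite divr_gt0// ltr0n expn_gt0.
  have eE : 3 / (2 ^ k)%N%:R = (2 ^ k)%N%:R^-1 + (2 ^ k)%N%:R * e :> R.
    by rewrite /e expnD natrM; field; rewrite gt_eqF.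
  rewrite eE; apply: (@decay_step _ T R P U mU PU (walk k) (oscb k)%:R _ _ (s - 2 ^ k)) => //.
  - exact: scale_gt0.
  - exact: measurable_walk.
  - by move=> u; exact: walk_itv.
  - exact: osc_walk.
  - exact: ltW.
  have mm0 : 0 < (2 ^ (k + k))%N%:R :> R by rewrite ltr0n expn_gt0.
  have eh : e = (2 ^ (k + k))%N%:R^-1 + (2 ^ (k + k))%N%:R^-1.
    by rewrite /e mulr_natl mulr2n.
  have ei : 0 < (2 ^ (k + k))%N%:R^-1 :> R by rewrite invr_gt0.
  move=> j jk jj; have [js|js] := ltnP (2 ^ k + j) s.
    left; apply: (@le_trans _ _ (2 ^ (k + k))%N%:R^-1); last by lra.
    rewrite ler_pdivrMr// ler_pdivlMl//; apply: le_trans ts.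
    have -> : 3 * (scale k j)%:R ^+ 4 * (oscb k)%:R
        = (3 * scale k j ^ 4 * oscb k)%N%:R :> R by rewrite !natrM natrX.
    rewrite -natrM ler_nat mulnA.
    have := @oscb_step k j s.-1 jk; rewrite prednK//; apply; lia.
  (* With the resonant index excluded, the scale is at least 2^(expo (s + 1)), which exceeds t by a
     factor of at least 2^(s + 1). *)
  have {}js : (s.+1 <= 2 ^ k + j)%N by move: jj; lia.
  right; rewrite eh; apply: lerD.
    rewrite ler_pdivrMr// ler_pdivlMl//; apply: le_trans ts.
    rewrite -natrM ler_nat /oscb -expnD leq_exp2l//.
    have := expo_sub_homo k1 ks; have := expo_ge k1; have := ltn_expl k (isT : 1 < 2)%N.
    by move: (expo (2 ^ k)) (expo s) (2 ^ k)%N => E E' K; lia.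
  have aR : 0 < (scale k j)%:R :> R by rewrite ltr0n scale_gt0.
  rewrite expnD natrM invfM ler_pM2r ?invr_gt0// ler_pdivrMr// ler_pdivlMl//.
  apply: le_trans (_ : (2 ^ k)%N%:R * (2 ^ (expo s.+1 - s.+1))%N%:R <= _).
    by rewrite ler_pM2l// ltW.
  rewrite -natrM ler_nat -expnD; apply: leq_trans (scale_ge k j).
  rewrite leq_exp2l//; apply: leq_trans (expo_homo js).
  have := @expo_ge s.+1 isT; have := ltn_expl k (isT : 1 < 2)%N.
  by move: (expo s.+1) (2 ^ k)%N ks => E K; lia.
(* The later steps move the point by at most [radius k.+1], and expo (s + 1) <= expo (2^(k+1)) makes
   this tiny compared with 1/t. *)
have tail : `|\int[P]_(u in D) cos (t * limit u + z)
              - \int[P]_(u in D) cos (t * walk k.+1 u + z)| <= (2 ^ k)%N%:R^-1.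
  rewrite -RintegralB//; [|exact: integrable_cosM|exact: integrable_cosM].
  apply: (@le_trans _ _ (t * radius k.+1 * fine (P D))).
    apply: Rintegral_norm_le => //.
      apply: (@integrable_bounded _ _ _ _ _ _ (1 + 1)) => //.
        by apply: measurable_funB; apply: measurable_cosM.
      move=> u; apply: le_trans (ler_normB _ _) _.
      by apply: lerD; exact: cos_norm_le1.
    move=> u _; apply: le_trans (cos_lipschitz _ _) _.
    rewrite (_ : _ - _ = t * (limit u - walk k.+1 u)); last by ring.
    by rewrite normrM gtr0_norm// ler_pM2l//; exact: limit_near.
  apply: (@le_trans _ _ (t * radius k.+1)).
    rewrite ler_piMr ?mulr_ge0 ?(ltW t0) ?(ltW (radius_gt0 _))//.
    by rewrite -[leRHS]subr0; exact: PU.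
  rewrite /radius mulrA ler_pdivrMr ?ltr0n ?expn_gt0// ler_pdivlMl//.
  apply: le_trans (_ : (2 ^ k * (2 ^ (expo s.+1 - s.+1) * 2))%N%:R <= _).
    by rewrite !natrM ler_pM2l// ler_pM2r// ltW.
  rewrite ler_nat -expnSr -expnD leq_exp2l//.
  have : (expo s.+1 <= expo (2 ^ k.+1))%N by exact: expo_homo.
  have := @expo_ge s.+1 isT; have := ltn_expl k (isT : 1 < 2)%N.
  by move: (expo s.+1) (expo (2 ^ k.+1)) (2 ^ k)%N ks => E E' K; lia.
apply: (@le_trans _ _ (4 / (2 ^ k)%N%:R)).
  rewrite -[X in `|X|](subrK (\int[P]_(u in D) cos (t * walk k.+1 u + z))).
  apply: le_trans (ler_normD _ _) _.
  rewrite (_ : 4 / _ = (2 ^ k)%N%:R^-1 + 3 / (2 ^ k)%N%:R); first exact: lerD.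
  by field; rewrite gt_eqF.
rewrite ler_pdivrMr// mulrAC ler_pdivlMr ?ltr0n//.
have : s%:R <= (2 ^ k.+1)%N%:R :> R by rewrite ler_nat ltnW.
by rewrite expnS natrM; lra.
Qed.

End walk.

(** * Long blocks of zeros exclude normality *)

Section nonnormality.
Variable R : realType.

(** Multiplying by b^(j-N) <= b^(3N) keeps the excess over the integer b^(j-N) c below 1, so the
    truncation is this integer, a multiple of b. *)
Lemma digit_block0 (b N c j : nat) (x : R) : (2 <= b)%N ->
  c%:R <= (b ^ N)%N%:R * x < c%:R + ((b ^ N)%N%:R ^+ 3)^-1 ->
  (N < j <= 4 * N)%N -> digit b x j = 0%N.
Proof.
move=> b2 /andP[h1 h2] /andP[Nj jN]; have b0 : (0 < b)%N by exact: ltnW.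
have bj : b%:R ^+ j = (b ^ (j - N))%N%:R * (b ^ N)%N%:R :> R.
  by rewrite -natrM -expnD subnK ?natrX// ltnW.
have r0 : 0 < (b ^ (j - N))%N%:R :> R by rewrite ltr0n expn_gt0 b0.
have a0 : 0 < (b ^ N)%N%:R ^+ 3 :> R by rewrite exprn_gt0// ltr0n expn_gt0 b0.
rewrite /digit (_ : Num.truncn _ = b ^ (j - N) * c)%N.
  by rewrite -(prednK (n := j - N)) ?subn_gt0// expnS -mulnA modnMr.
apply: truncn_def; rewrite bj -mulrA natrM ler_pM2l// h1/=.
rewrite -natr1 natrM; apply: lt_le_trans (_ : (b ^ (j - N))%N%:R *
  (c%:R + ((b ^ N)%N%:R ^+ 3)^-1) <= _); first by rewrite ltr_pM2l.
rewrite mulrDr lerD2l ler_pdivrMr// mul1r -natrX ler_nat -expnM leq_exp2l//.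
lia.
Qed.

(** For arbitrarily large N, at least 3N of the first 4N digits are 0: a frequency of 3/4, whereas
    normality asks for a limit 1/b <= 1/2. *)
Lemma zero_blocks_nonnormal (b : nat) (x : R) : (2 <= b)%N ->
  (forall K : nat, exists2 N, (K <= N)%N &
     forall j, (N < j <= 4 * N)%N -> digit b x j = 0%N) ->
  ~ normal b x.
Proof.
move=> b2 Hx nx; have b0 : (0 < b)%N by exact: ltnW.
have := nx 1%N [tuple Ordinal b0] isT; rewrite expr1 => cv.
have b12 : b%:R^-1 <= 2^-1 :> R by rewrite lef_pV2 ?posrE ?ltr0n// ler_nat.
have lt34 : b%:R^-1 < 3 / 4 :> R by lra.
have /cvgr_lt/(_ _ lt34)[K _ HK] := cv.
have [N KN HN] := Hx K.+1; have N0 : (0 < N)%N by exact: leq_trans KN.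
have := HK (4 * N)%N; rewrite /= => /(_ _)/wrap[]; first by lia.
rewrite ltNge => /negP; apply.
have N4 : 0 < (4 * N)%:R :> R by rewrite ltr0n muln_gt0.
rewrite ler_pdivlMr// (_ : 3 / 4 * (4 * N)%:R = (3 * N)%N%:R); last first.
  by rewrite !natrM; field.
rewrite ler_nat (_ : 4 * N = N + 3 * N)%N; last by lia.
rewrite iotaD count_cat; apply: leq_trans (leq_addl _ _).
rewrite (_ : count _ _ = 3 * N)%N//; apply/eqP.
rewrite -[X in _ == X](size_iota (1 + N)) -all_count; apply/allP => j.
rewrite mem_iota => jN; apply/forallP => i.
by rewrite ord1 addn0 HN/= ?(tnth_nth (Ordinal b0))//; lia.
Qed.

End nonnormality.

(** * The law of the limit point *)

Section limit_law.
Variable R : realType.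
Local Notation P := (uniform_prob (@ltr01 R)).
Local Notation T := (measurableTypeR R).

Definition zero_block (a : nat) : set R :=
  \bigcup_c [set x | c%:R <= a%:R * x < c%:R + (a%:R ^+ 3)^-1].

(** A Borel set of absolutely non-normal numbers that carries the law; its complement is the null
    set used for the almost-everywhere statement. *)
Definition zero_blocks : set R := \bigcap_k \bigcup_j (zero_block (scale k j)).

Lemma measurable_zero_blocks : measurable (zero_blocks : set T).
Proof.
apply: bigcap_measurable => // k _; apply: bigcup_measurable => j _.
apply: bigcup_measurable => c _.
by apply: (@measurable_itv_preimage _ T R); exact: measurable_funM.
Qed.

Lemma zero_blocks_absnonnormal x : zero_blocks x -> absolutely_nonnormal x.
Proof.
move=> Bx b b2; apply: zero_blocks_nonnormal => // K.
(* The 2-adic valuation of k is b - 2, so step k uses base b, while k >= K. *)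
pose k := (2 ^ (b - 2) * (2 * K).+1)%N.
have bk : base k = b.
  rewrite /base /k lognM ?expn_gt0// pfactorK// logn_coprime ?addn0 ?subnK//.
  by rewrite coprime2n /= mul2n odd_double.
have [j _ [c _ /= Hc]] := Bx k I; exists (expo (2 ^ k + j)).
  have k1 : (1 <= 2 ^ k + j)%N by rewrite addn_gt0 expn_gt0.
  have := expo_ge k1; have := ltn_expl k (isT : 1 < 2)%N.
  have : (K <= k)%N by rewrite /k; have := expn_gt0 2 (b - 2); nia.
  by move: (2 ^ k)%N (expo _); lia.
by move=> i iN; apply: (digit_block0 (N := expo (2 ^ k + j)) (c := c)) => //; rewrite -bk.
Qed.

(* The identity, read as a random variable on [T] with values in [R], two types
   whose measurable structures have different displays. *)
Definition id_T : T -> R := id.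

Lemma measurable_id_T : measurable_fun setT id_T.
Proof. exact: measurable_id. Qed.

Lemma id_T_itv (l r : R) : [set u : T | l <= id_T u < r] = `[l, r[%classic.
Proof. by apply/seteqP; split => u /=; rewrite in_itv. Qed.

Lemma id_T_prob_le (l r : R) : 0 <= l -> l <= r -> r <= 1 ->
  fine (P [set u | l <= id_T u < r]) <= r - l.
Proof.
move=> l0 lr r1; rewrite id_T_itv -lee_fin fineK ?fin_num_measure//.
exact: uniform_prob_le.
Qed.

Lemma osc_id_T : osc P id_T id_T 2.
Proof.
move=> t z l r p q t0 l0 r1.
rewrite (_ : box id_T id_T l r p q = `[Num.max l p, Num.min r q[%classic).
  by apply: Rintegral_cos_itv => //; rewrite ?le_max ?l0// ge_min r1.
apply/seteqP; split => u /=; rewrite in_itv/= ge_max lt_min.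
  by move=> [/andP[-> ->] /andP[-> ->]].
by rewrite /box /id_T => /andP[/andP[lu pu] /andP[ur uq]]; split; apply/andP.
Qed.

Definition rv : T -> T := limit id_T.

Lemma measurable_rv : measurable_fun setT rv.
Proof. exact: (measurable_limit measurable_id_T). Qed.

HB.instance Definition _ := isMeasurableFun.Build _ _ T T rv measurable_rv.

Definition law : probability T R := distribution P (rv : {mfun T >-> T}).

Lemma law_itv01 : law `[0, 1[%classic = 1%E.
Proof.
apply/eqP; rewrite eq_le probability_le1//= -{1}(uniform_prob01 R).
apply: le_measure; rewrite ?inE//.
  by rewrite -[X in measurable X]setTI; exact: measurable_rv.
move=> u /=; rewrite !in_itv/=; exact: limit_itv.
Qed.

Lemma law_nonnormal : {ae law, forall x, absolutely_nonnormal x}.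
Proof.
exists (~` zero_blocks); split.
- by apply: measurableC; exact: measurable_zero_blocks.
- apply: uniform_prob_null => [|u nb].
    rewrite -[X in measurable X]setTI; apply: measurable_rv => //.
    by apply: measurableC; exact: measurable_zero_blocks.
  apply/negP => u01; apply: nb => k _.
  have [j [c [_ _ h]]] := @limit_block _ T R id_T k u u01.
  by exists j => //; exists c.
- by move=> x nx Bx; apply: nx; exact: zero_blocks_absnonnormal.
Qed.

Lemma law_cos (s : nat) (t z : R) : (1 <= s)%N ->
  (2 ^ (expo s - s))%N%:R <= t < (2 ^ (expo s.+1 - s.+1))%N%:R ->
  `|\int[law]_(x in `[0, 1[) cos (t * x + z)| <= 8 / s%:R.
Proof.
move=> s1 ts; set f := fun x : T => cos (t * x + z).
have mf : measurable_fun setT f by exact: (@measurable_cosM _ T R id).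
have mfr : measurable_fun setT (f \o rv) by exact: measurableT_comp.
set D : set T := rv @^-1` `[0, 1[%classic.
have mD : measurable D by rewrite -[D]setTI; exact: measurable_rv.
have fr1 u : `|(f \o rv) u| <= 1 by exact: cos_norm_le1.
have fi (E : set T) : measurable E -> P.-integrable E (EFin \o (f \o rv)).
  by move=> mE; exact: integrable_bounded mE mfr fr1.
have -> : \int[law]_(x in `[0, 1[) f x = \int[P]_(u in D) f (rv u).
  have mfE : measurable_fun setT (EFin \o f) by exact/measurable_EFinP.
  congr fine; exact: (@integral_pushforward _ _ T T R rv measurable_rv P
    `[0, 1[%classic (EFin \o f) mfE (fi _ mD) (measurable_itv _)).
(* The preimage of [0, 1) may also contain points outside [0, 1); they form a null set. *)
have sub : `[0, 1[%classic `<=` D.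
  by move=> u /=; rewrite /D /= !in_itv/=; exact: limit_itv.
have -> : D = `[0, 1[%classic `|` (D `\` `[0, 1[%classic).
  by rewrite setDUK.
have mDD : measurable (D `\` `[0, 1[%classic) by exact: measurableD.
rewrite Rintegral_setU//; last 2 first.
- by rewrite setDUK//; exact: fi.
- by apply/disj_set2P; rewrite setDIK.
have P0 : P (D `\` `[0, 1[%classic) = 0%E.
  by apply: uniform_prob_null => // u [_ /=]; rewrite in_itv/= => /negP.
have -> : \int[P]_(u in D `\` `[0, 1[) (f (rv u)) = 0.
  have E0 : 1 * fine (P (D `\` `[0, 1[%classic)) = 0 by rewrite P0 mulr0.
  apply/eqP; rewrite -normr_le0 -[leRHS]E0.
  exact: Rintegral_norm_le mDD (fi _ mDD) (fun u _ => fr1 u).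
rewrite addr0 -id_T_itv.
exact: (@limit_decay _ T R P id_T measurable_id_T id_T_prob_le osc_id_T s t z s1 ts).
Qed.

(** * From the index of a frequency to the triple logarithm *)

Lemma expo_index : exists2 h : R, 0 < h & forall t, h <= t ->
  exists2 s, (1 <= s)%N &
    (2 ^ (expo s - s))%N%:R <= t < (2 ^ (expo s.+1 - s.+1))%N%:R.
Proof.
(* The index 1 is made opaque: 2^(expo 1 - 1) is 2^255, not to be computed in unary. *)
have [r r1] : exists r, (1 <= r)%N by exists 1%N.
exists (2 ^ (expo r - r))%N%:R => [|t rt]; first by rewrite ltr0n expn_gt0.
pose Q s := (1 <= s)%N && ((2 ^ (expo s - s))%N%:R <= t).
have exQ : exists s, Q s by exists r; rewrite /Q r1.
have Qb s : Q s -> (s <= Num.truncn t)%N.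
  move=> /andP[s1 st]; rewrite truncn_ge_nat; last exact: le_trans st.
  apply: le_trans st; rewrite ler_nat.
  apply: leq_trans (ltnW (ltn_expl s (isT : 1 < 2)%N)) _; rewrite leq_exp2l//.
  by have := expo_ge s1; lia.
have [s /andP[s1 st] smax] := ex_maxnP exQ Qb; exists s => //.
rewrite st ltNge /=; apply/negP => sS.
by have := smax s.+1; rewrite /Q sS /= ltnn => /(_ isT).
Qed.

Lemma ln_exp2 m : ln (2 ^ m)%N%:R <= m%:R :> R.
Proof.
rewrite natrX lnXn// -[leRHS]mulr_natl mulr1 -[leLHS]mulr_natl ler_piMr//.
by have := @le_ln1Dx R 1; rewrite -[1 + 1]/(2 : R); apply; lra.
Qed.

(** The bound on y is a tower 2^(2^(2^(s + 3))), and as ln 2 <= 1 each logarithm removes one level.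
    The lower bound on y keeps the successive logarithms positive. *)
Lemma ln3_le (y : R) (s : nat) : expR (expR (expR 1)) <= y ->
  y < (2 ^ expo s.+1)%N%:R -> 0 < ln (ln (ln y)) <= s%:R + 3.
Proof.
move=> yC ys.
have mono (u v : R) : 0 < u -> u <= v -> ln u <= ln v.
  by move=> u0 uv; rewrite ler_ln ?posrE// (lt_le_trans u0).
have y1 : expR (expR 1) <= ln y by rewrite -[leLHS]expRK; apply: mono; rewrite ?expR_gt0.
have y2 : expR 1 <= ln (ln y) by rewrite -[leLHS]expRK; apply: mono; rewrite ?expR_gt0.
have y3 : 1 <= ln (ln (ln y)) by rewrite -[leLHS]expRK; apply: mono; rewrite ?expR_gt0.
rewrite (lt_le_trans ltr01 y3)/=.
have z1 : ln y <= (expo s.+1)%:R.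
  apply: le_trans (ln_exp2 _); apply: mono; last exact: ltW.
  by apply: lt_le_trans yC; rewrite expR_gt0.
have z2 : ln (ln y) <= (2 ^ (s.+1 + 2))%N%:R.
  apply: le_trans (ln_exp2 _); apply: mono => //.
  by apply: lt_le_trans y1; rewrite expR_gt0.
apply: (@le_trans _ _ (s.+1 + 2)%:R); last by rewrite -natrD addSnnS.
apply: le_trans (ln_exp2 _); apply: mono => //.
by apply: lt_le_trans y2; rewrite expR_gt0.
Qed.

Lemma normc_le (a b : R) : `|a +i* b| <= (`|a| + `|b|)%:C.
Proof.
rewrite normc_def lecR/= -(ler_pXn2r (n := 2)) ?nnegrE ?sqrtr_ge0 ?addr_ge0//.
rewrite sqr_sqrtr ?addr_ge0 ?sqr_ge0// -(real_normK (num_real a)) -(real_normK (num_real b)).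
by rewrite sqrrD -addrA (addrC (_ *+ 2)) addrA lerDl mulrn_wge0// mulr_ge0.
Qed.

(** Reduces to positive frequencies: the arbitrary phase absorbs the sign. *)
Lemma cos_freq (w x z : R) : cos (w * x + z) =
  cos (`|w| * x + (if 0 <= w then z else - z)).
Proof.
have [w0|w0] := leP 0 w; first by rewrite ger0_norm.
by rewrite ltr0_norm// -cosN opprD mulNr.
Qed.

End limit_law.

Unset Implicit Arguments.

Theorem proposition11p1 (R : realType) :
  exists (C : R) (mu : probability (measurableTypeR R) R),
    [/\ 0 < C,
        mu `[0, 1[%classic = 1%E,
        {ae mu, forall x, absolutely_nonnormal x} &
        forall n : int, C <= `|n|%:~R ->
          `|fourier_coef mu n| <= (C * (iter 3 (@ln R) `|n|%:~R)^-1)%:C].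
Proof.
have [h h0 hP] := expo_index R.
have e0 := expR_gt0 (expR (expR 1) : R); set e := expR (expR _) in e0 *.
(* [h] makes the index s available and [e] makes the triple logarithm positive. The real and
   imaginary parts give 16/s, and the triple logarithm is at most s + 3 <= 4s, whence 64. *)
exists (64 + h + e), (law R); split; first by rewrite !addr_gt0.
- exact: law_itv01.
- exact: law_nonnormal.
move=> n; rewrite intr_norm; set y : R := `|n%:~R| => yC.
set w := - (2 * pi * n%:~R) : R.
have wE : `|w| = 2 * pi * y.
  by rewrite /w normrN normrM gtr0_norm// mulr_gt0// pi_gt0.
have p2 := pi_ge2 R.
have yw : y <= `|w| by rewrite wE; nra.
have [s s1 ws] : exists2 s, (1 <= s)%N &
    (2 ^ (expo s - s))%N%:R <= `|w| < (2 ^ (expo s.+1 - s.+1))%N%:R.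
  by apply: hP; apply: le_trans yw; lra.
have s0 : 0 < s%:R :> R by rewrite ltr0n.
have /andP[L0 Ls] : 0 < ln (ln (ln y)) <= s%:R + 3.
  apply: ln3_le; first by apply: le_trans yC; rewrite lerDr; lra.
  apply: (le_lt_trans yw); case/andP: ws => _ /lt_le_trans; apply.
  by rewrite ler_nat leq_exp2l// leq_subr.
(* One estimate serves both parts: the sine is a cosine with phase -pi/2. *)
have key z : `|\int[law R]_(x in `[0, 1[) cos (w * x + z)| <= 8 / s%:R.
  under eq_Rintegral do rewrite cos_freq.
  exact: law_cos.
rewrite /fourier_coef /cintegral; apply: le_trans (normc_le _ _) _; rewrite lecR /=.
have -> : \int[law R]_(x in `[0, 1[) cos (- (2 * pi * n%:~R * x)) =
    \int[law R]_(x in `[0, 1[) cos (w * x + 0).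
  by apply: eq_Rintegral => x _; rewrite addr0 /w mulNr.
have -> : \int[law R]_(x in `[0, 1[) sin (- (2 * pi * n%:~R * x)) =
    \int[law R]_(x in `[0, 1[) cos (w * x + - (pi / 2)).
  by apply: eq_Rintegral => x _; rewrite cosBpihalf /w mulNr.
apply: le_trans (lerD (key _) (key _)) _.
rewrite ler_pdivlMr// -mulrDl mulrAC ler_pdivrMr//.
have : 1 <= s%:R :> R by rewrite ler1n.
nra.
Qed.
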